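(* Let $G$ be a finite simple graph with $n=|V_G|$ vertices. If $G$ has a flexible labeling, then $|E_G|\le \frac{n(n-1)}{2}-(n-2)$.
   Context: For a graph $G$ with $|E_G|\ge1$, a labeling is a map $\lambda\colon E_G\to\mathbb{R}_{>0}$. A realization compatible with $\lambda$ is a map $\rho\colon V_G\to\mathbb{R}^2$ with $\|\rho(u)-\rho(v)\|=\lambda(uv)$ for all $uv\in E_G$; two realizations are equivalent if they differ by composition with an orientation-preserving Euclidean isometry of $\mathbb{R}^2$. A labeling is flexible if it has infinitely many compatible realizations up to equivalence. *)

(* Defs.v *)
From mathcomp Require Import all_boot all_order all_algebra.
From mathcomp Require Import boolp classical_sets cardinality reals.

Set Implicit Arguments.
Unset Strict Implicit.
Unset Printing Implicit Defensive.

Import Order.TTheory GRing.Theory Num.Theory.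

Local Open Scope ring_scope.

(* The real numbers are an arbitrary R : realType (MathComp-Analysis), which is
   determined up to isomorphism. *)

Record sgraph (V : finType) := SGraph {
  adj :> rel V;
  adj_sym : symmetric adj;
  adj_irr : irreflexive adj }.

Definition edges (V : finType) (G : sgraph V) : {set {set V}} :=
  [set [set p.1; p.2] | p in [set p : V * V | adj G p.1 p.2]]%SET.

(* The norm that MathComp-Analysis puts on 'rV[R]_2 is the sup norm, so the
   Euclidean distance of the plane has to be spelled out. *)
Definition edist (R : realType) (x y : 'rV[R]_2) : R :=
  Num.sqrt (\sum_(i < 2) (x 0 i - y 0 i) ^+ 2).

Definition isometry (R : realType) (f : 'rV[R]_2 -> 'rV[R]_2) : Prop :=
  forall x y, edist (f x) (f y) = edist x y.

(* Points are row vectors, so the linear part A acts on the right. *)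
Definition orientation_preserving (R : realType) (f : 'rV[R]_2 -> 'rV[R]_2) :
    Prop :=
  exists (A : 'M[R]_2) (b : 'rV[R]_2),
    (forall x, f x = x *m A + b) /\ 0 < \det A.

(* A labeling is encoded by a function on all vertex sets; its values outside
   edges G are irrelevant to everything below. *)
Definition is_labeling (R : realType) (V : finType) (G : sgraph V)
    (l : {set V} -> R) : Prop :=
  forall e, e \in edges G -> 0 < l e.

(* Realizations need not be injective. *)
Definition compatible (R : realType) (V : finType) (G : sgraph V)
    (l : {set V} -> R) (rho : V -> 'rV[R]_2) : Prop :=
  forall u v, adj G u v -> edist (rho u) (rho v) = l [set u; v]%SET.

Definition equivalent (R : realType) (V : finType)
    (rho rho' : V -> 'rV[R]_2) : Prop :=
  exists f : 'rV[R]_2 -> 'rV[R]_2,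
    [/\ isometry f, orientation_preserving f & rho' = f \o rho].

Definition realization_classes (R : realType) (V : finType) (G : sgraph V)
    (l : {set V} -> R) : set (set (V -> 'rV[R]_2)) :=
  [set [set rho' | equivalent rho rho'] | rho in [set rho | compatible G l rho]]%classic.

Definition flexible (R : realType) (V : finType) (G : sgraph V)
    (l : {set V} -> R) : Prop :=
  infinite_set (realization_classes G l).

Definition has_flexible_labeling (R : realType) (V : finType) (G : sgraph V) :
    Prop :=
  exists l : {set V} -> R, is_labeling G l /\ flexible G l.

(* Main.v *)
(** If more than [n(n-1)/2 - (n-2)] edges were present, the complement of [G]
    would have at most [n-3] edges, hence at least three components.  Vertices
    in different components of the complement are adjacent in [G], so one vertex
    from each of three components gives a triangle such that every vertex is
    adjacent to at least two of its corners.  The corners are always realized by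
    three distinct points, so once the triangle is placed every vertex lies on
    two circles with different centres: up to direct isometries a realization is
    determined by finitely many orientation signs. *)

Require Import Defs.
From mathcomp Require Import all_boot all_order all_algebra.
From mathcomp Require Import boolp classical_sets cardinality reals.
From mathcomp Require Import ring lra zify.
Import Order.TTheory GRing.Theory Num.Theory.
Local Open Scope ring_scope.

(** * Components of the complement graph and their number *)

Section Counting.
Set Implicit Arguments.
Unset Strict Implicit.

Variable V : finType.

(* Contracting one more pair merges at most two classes. *)
Lemma contraction_card (s : seq {set V}) :
    (forall e, e \in s -> #|e| = 2) ->
  exists f : V -> V,
    (forall e u v, e \in s -> u \in e -> v \in e -> f u = f v) /\
    (#|V| <= #|[set f x | x : V]%SET| + size s)%N.
Proof.
elim: s => [|e s IHs] card2.
  by exists id; split => //; rewrite card_imset ?cardsT ?addn0 //; exact: inj_id.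
have [|f [fs cardf]] := IHs; first by move=> d ds; apply: card2; rewrite inE ds orbT.
have /eqP/cards2P[a [b [_ ->]]] : #|e| = 2 by apply: card2; rewrite mem_head.
exists (fun x => if f x == f b then f a else f x); split=> [d u v|].
  rewrite inE => /orP[/eqP -> | ds ud vd]; last by rewrite (fs d u v).
  by rewrite !inE => /orP[] /eqP-> /orP[] /eqP->; rewrite ?eqxx //; case: ifP.
apply: (leq_trans cardf); rewrite /= addnS -addSn leq_add2r.
rewrite (cardsD1 (f b) [set f x | x : V]%SET) imset_f // add1n ltnS.
apply: subset_leq_card; apply/fintype.subsetP => y.
rewrite !inE => /andP[yfb /imsetP[x _ yE]].
by apply/imsetP; exists x => //; rewrite -yE (negPf yfb).
Qed.

Definition nonedges (G : sgraph V) : {set {set V}} :=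
  [set e : {set V} | (#|e| == 2) && (e \notin edges G)]%SET.

Lemma card_edges_nonedges (G : sgraph V) :
  (#|edges G| + #|nonedges G|)%N = 'C(#|V|, 2).
Proof.
rewrite -card_draws -[RHS](cardsID (edges G)); congr (_ + _)%N.
  apply: eq_card => e; rewrite !inE andb_idl // => /imsetP[[u v]].
  by rewrite inE /= => uv ->; rewrite cards2; case: (u =P v) uv => [->|]; rewrite ?adj_irr.
by apply: eq_card => e; rewrite !inE andbC.
Qed.

Definition corners (G : sgraph V) (a b c : V) : Prop :=
  [/\ G a b, G a c, G b c
    & forall v, [\/ G a v /\ G b v, G a v /\ G c v | G b v /\ G c v]].

(** Contracting all non-edges leaves at least three classes. One vertex is taken from each; the
    class of any [v] agrees with at most one of these three, so [v] is adjacent to the other two. *)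
Lemma corners_exist (G : sgraph V) :
  (#|nonedges G| + 3 <= #|V|)%N -> exists a b c, corners G a b c.
Proof.
move=> Vlarge; have [e|f [fE cardf]] := @contraction_card (enum (nonedges G)).
  by rewrite mem_enum inE => /andP[/eqP].
have adjf u v : f u != f v -> G u v.
  move=> fuv; have uv : u != v by apply: contraNneq fuv => ->.
  apply: contraNT fuv => nGuv; apply/eqP/(fE [set u; v]%SET); rewrite ?inE ?eqxx ?orbT //.
  rewrite mem_enum inE cards2 uv /=; apply/imsetP => -[[x y]].
  (* Testing membership of all four vertices forces [(x, y)] to be [(u, v)] or [(v, u)]. *)
  rewrite inE /= => Gxy /setP xyE; move: (xyE u) (xyE v) (xyE x) (xyE y) nGuv uv Gxy.
  rewrite !inE !eqxx !orbT /= => /esym/orP[] /eqP-> /esym/orP[] /eqP->;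
    rewrite ?eqxx // => _ _; first by move=> /negPf ->.
  by rewrite adj_sym => /negPf ->.
have : (2 < #|[set f x | x : V]%SET|)%N.
  by move: (leq_trans Vlarge cardf); rewrite -cardE addnC leq_add2r.
move=> /card_gt2P[x [y [z [[]]]]].
move=> /imsetP[a _ ->] /imsetP[b _ ->] /imsetP[c _ ->] [ab bc ca].
exists a, b, c; split; [exact: adjf|by rewrite adj_sym; apply: adjf|exact: adjf|].
move=> v; have [avE|av] := eqVneq (f a) (f v).
  by apply: Or33; split; apply: adjf; rewrite -avE // eq_sym.
have [bvE|bv] := eqVneq (f b) (f v).
  by apply: Or32; split; apply: adjf; rewrite -?bvE // eq_sym.
by apply: Or31; split; apply: adjf.
Qed.

End Counting.

(** * Plane geometry in coordinates *)

Section Plane.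
Set Implicit Arguments.
Unset Strict Implicit.

Variable R : realType.
Implicit Types p q x y : 'rV[R]_2.

Definition sqdist x y : R := (x 0 0 - y 0 0) ^+ 2 + (x 0 1 - y 0 1) ^+ 2.

(** Twice the signed area of the triangle [p q x]; its sign tells the side of the line [p q] on
    which [x] lies. *)
Definition orient p q x : R :=
  (q 0 0 - p 0 0) * (x 0 1 - p 0 1) - (q 0 1 - p 0 1) * (x 0 0 - p 0 0).

Lemma edistE x y : edist x y = Num.sqrt (sqdist x y).
Proof.
rewrite /edist /sqdist !big_ord_recl big_ord0 addr0.
by congr (Num.sqrt (_ + (x _ _ - y _ _) ^+ 2)); apply/val_inj.
Qed.

Lemma sqdist_edist {x y x' y'} :
  edist x y = edist x' y' -> sqdist x y = sqdist x' y'.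
Proof.
rewrite !edistE => /(congr1 (fun z => z ^+ 2)).
by rewrite !sqr_sqrtr // /sqdist addr_ge0 // sqr_ge0.
Qed.

Lemma row2P x y : x 0 0 = y 0 0 -> x 0 1 = y 0 1 -> x = y.
Proof.
move=> xy0 xy1; apply/rowP => i; case: (unliftP ord0 i) => [j|] -> //.
by rewrite (ord1 j); have -> : lift ord0 0 = 1 :> 'I_2 by apply/val_inj.
Qed.

(** Two circles with distinct centres meet in at most two points, mirror images in the line of
    centres; the sign selects one. *)
Lemma trilateration p q x y :
    0 < edist p q -> edist p x = edist p y -> edist q x = edist q y ->
    (0 < orient p q x) = (0 < orient p q y) -> x = y.
Proof.
rewrite edistE sqrtr_gt0 => pq /sqdist_edist px /sqdist_edist qx sgn.
(* Subtracting the two distance equations cancels the squares of the coordinates. *)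
have dotE : (q 0 0 - p 0 0) * (x 0 0 - y 0 0) + (q 0 1 - p 0 1) * (x 0 1 - y 0 1) = 0.
  by move: px qx; rewrite /sqdist; lra.
have oxy : orient p q x = orient p q y.
  (* Lagrange's identity: cross^2 + dot^2 is the product of the squared norms. *)
  have /eqP : orient p q x ^+ 2 = orient p q y ^+ 2.
    have := congr1 ( *%R (sqdist p q)) px.
    have : ((q 0 0 - p 0 0) * (x 0 0 - p 0 0) + (q 0 1 - p 0 1) * (x 0 1 - p 0 1)) ^+ 2
         = ((q 0 0 - p 0 0) * (y 0 0 - p 0 0) + (q 0 1 - p 0 1) * (y 0 1 - p 0 1)) ^+ 2.
      by congr (_ ^+ 2); move: dotE; lra.
    by rewrite /orient /sqdist; lra.
  rewrite eqf_sqr => /orP[/eqP//|/eqP oN]; move: sgn; rewrite oN.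
  (* The test [0 <] does not separate zero from negative values, but two opposite numbers that are
     both non-positive vanish. *)
  by case: ltP; case: ltP => //; lra.
have pqN0 : sqdist p q != 0 by rewrite gt_eqF.
apply: row2P; apply: (mulfI pqN0).
  (* Cramer's rule: [x - y] is recovered from its dot and cross products with [q - p]. *)
  have -> : sqdist p q * x 0 0 = sqdist p q * y 0 0
      + (q 0 0 - p 0 0) * ((q 0 0 - p 0 0) * (x 0 0 - y 0 0) + (q 0 1 - p 0 1) * (x 0 1 - y 0 1))
      - (q 0 1 - p 0 1) * (orient p q x - orient p q y) by rewrite /sqdist /orient; ring.
  by rewrite dotE oxy subrr !mulr0 subr0 addr0.
have -> : sqdist p q * x 0 1 = sqdist p q * y 0 1
    + (q 0 1 - p 0 1) * ((q 0 0 - p 0 0) * (x 0 0 - y 0 0) + (q 0 1 - p 0 1) * (x 0 1 - y 0 1))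
    + (q 0 0 - p 0 0) * (orient p q x - orient p q y) by rewrite /sqdist /orient; ring.
by rewrite dotE oxy subrr !mulr0 !addr0.
Qed.

Lemma direct_isometry p q p' q' : 0 < edist p q -> edist p q = edist p' q' ->
  exists f, [/\ Defs.isometry f, orientation_preserving f, f p = p', f q = q'
    & forall x y z, orient (f x) (f y) (f z) = orient x y z].
Proof.
rewrite {1}edistE sqrtr_gt0 => d_gt0 /sqdist_edist dE.
have dN0 : sqdist p q != 0 by rewrite gt_eqF.
set u0 := q 0 0 - p 0 0; set u1 := q 0 1 - p 0 1.
set w0 := q' 0 0 - p' 0 0; set w1 := q' 0 1 - p' 0 1.
(* In complex notation, [c + i s] is the quotient [(q' - p') / (q - p)], of modulus 1. *)
pose c := (u0 * w0 + u1 * w1) / sqdist p q.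
pose s := (u0 * w1 - u1 * w0) / sqdist p q.
have duE : sqdist p q = u0 ^+ 2 + u1 ^+ 2 by rewrite /sqdist /u0 /u1; ring.
have dwE : sqdist p q = w0 ^+ 2 + w1 ^+ 2 by rewrite dE /sqdist /w0 /w1; ring.
have cs : c ^+ 2 + s ^+ 2 = 1.
  rewrite /c /s !expr_div_n -mulrDl; apply: (canLR (mulfK _)); first by rewrite expf_neq0.
  by rewrite mul1r [RHS]expr2 {1}duE dwE; ring.
have cd : c * sqdist p q = u0 * w0 + u1 * w1 by rewrite divfK.
have sd : s * sqdist p q = u0 * w1 - u1 * w0 by rewrite divfK.
have cu : c * u0 - s * u1 = w0.
  apply: (mulIf dN0).
  have -> : (c * u0 - s * u1) * sqdist p q
          = c * sqdist p q * u0 - s * sqdist p q * u1 by ring.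
  by rewrite cd sd duE; ring.
have su : s * u0 + c * u1 = w1.
  apply: (mulIf dN0).
  have -> : (s * u0 + c * u1) * sqdist p q
          = s * sqdist p q * u0 + c * sqdist p q * u1 by ring.
  by rewrite cd sd duE; ring.
pose A : 'M[R]_2 := \matrix_(i, j) if i == j then c else if i == 0 then s else - s.
pose f x := x *m A + (p' - p *m A).
have f0 x : f x 0 0 = c * x 0 0 - s * x 0 1 + (p' 0 0 - (c * p 0 0 - s * p 0 1)).
  rewrite !mxE !big_ord_recl !big_ord0 !mxE /=.
  have -> : lift ord0 ord0 = 1 :> 'I_2 by apply/val_inj.
  by ring.
have f1 x : f x 0 1 = s * x 0 0 + c * x 0 1 + (p' 0 1 - (s * p 0 0 + c * p 0 1)).
  rewrite !mxE !big_ord_recl !big_ord0 !mxE /=.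
  have -> : lift ord0 ord0 = 1 :> 'I_2 by apply/val_inj.
  by rewrite /=; ring.
exists f; split.
- move=> x y; rewrite !edistE; congr Num.sqrt.
  (* Writing the factor 1 as [c ^+ 2 + s ^+ 2] turns the goal into a polynomial identity. *)
  rewrite -[RHS]mul1r -cs /sqdist !f0 !f1; ring.
- exists A, (p' - p *m A); split => //.
  have -> : \det A = c ^+ 2 + s ^+ 2; last by rewrite cs ltr01.
  rewrite (expand_det_row _ 0) !big_ord_recl big_ord0 /cofactor !det_mx11 !mxE.
  by rewrite /= /bump /=; ring.
- by rewrite /f addrC subrK.
- apply: row2P; rewrite ?f0 ?f1.
    have -> : q' 0 0 = p' 0 0 + w0 by rewrite /w0; ring.
    by rewrite -cu /u0 /u1; ring.
  have -> : q' 0 1 = p' 0 1 + w1 by rewrite /w1; ring.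
  by rewrite -su /u0 /u1; ring.
- move=> x y z; rewrite -[RHS]mul1r -cs /orient !f0 !f1; ring.
Qed.

End Plane.

(** * Finiteness of the set of realization classes *)

Section Rigidity.
Set Implicit Arguments.
Unset Strict Implicit.

Variables (R : realType) (V : finType).
Implicit Types (rho : V -> 'rV[R]_2) (G : sgraph V) (l : {set V} -> R).

Lemma equivalent_trans rho1 rho2 rho3 :
  equivalent rho1 rho2 -> equivalent rho2 rho3 -> equivalent rho1 rho3.
Proof.
move=> [f [f_iso [A [b [fE Apos]]] ->]] [g [g_iso [B [c [gE Bpos]]] ->]].
exists (g \o f); split=> //; first by move=> x y; rewrite /= g_iso f_iso.
exists (A *m B), (b *m B + c); split; last by rewrite det_mulmx mulr_gt0.
by move=> x; rewrite /= gE fE mulmxDl mulmxA addrA.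
Qed.

(** All three sides of the triangle are recorded because the pair of corners that locates [v] varies
    with [v]. The codomain is finite. *)
Definition signs (a b c : V) rho : {ffun V -> bool * bool * bool} :=
  [ffun v => (0 < orient (rho a) (rho b) (rho v),
              0 < orient (rho a) (rho c) (rho v),
              0 < orient (rho b) (rho c) (rho v))].

Lemma signs_equivalent G l a b c rho rho' :
    is_labeling G l -> corners G a b c ->
    compatible G l rho -> compatible G l rho' ->
    signs a b c rho = signs a b c rho' -> equivalent rho rho'.
Proof.
move=> l_gt0 [Gab Gac Gbc Gv] rhoP rhoP' /ffunP sgnE.
have edgeP u v : G u v -> [set u; v]%SET \in edges G.
  by move=> Guv; apply/imsetP; exists (u, v); rewrite ?inE.
have dist_gt0 u v : G u v -> 0 < edist (rho u) (rho v).
  by move=> Guv; rewrite rhoP //; apply/l_gt0/edgeP.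
have dist_eq u v : G u v -> edist (rho u) (rho v) = edist (rho' u) (rho' v).
  by move=> Guv; rewrite rhoP // rhoP'.
have [f [f_iso f_dir fa fb f_or]] := direct_isometry (dist_gt0 _ _ Gab) (dist_eq _ _ Gab).
have transfer u w v : f (rho u) = rho' u -> f (rho w) = rho' w ->
    G u w -> G u v -> G w v ->
    (0 < orient (rho u) (rho w) (rho v)) = (0 < orient (rho' u) (rho' w) (rho' v)) ->
    f (rho v) = rho' v.
  move=> fu fw Guw Guv Gwv sgn; apply: (@trilateration R (rho' u) (rho' w)).
  - by rewrite -dist_eq // dist_gt0.
  - by rewrite -dist_eq // -fu f_iso.
  - by rewrite -dist_eq // -fw f_iso.
  - by rewrite -sgn -fu -fw f_or.
(* The third corner is matched first, since other vertices may be located from it. *)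
have fc : f (rho c) = rho' c.
  by apply: (transfer a b) => //; have := sgnE c; rewrite !ffunE => -[].
exists f; split => //; apply: funext => v /=; apply: esym.
have := sgnE v; rewrite !ffunE => -[sab sac sbc].
by have [[av bv]|[av cv]|[bv cv]] := Gv v;
  [apply: (transfer a b)|apply: (transfer a c)|apply: (transfer b c)].
Qed.

Lemma finite_image_factor (T U : Type) (F : finType) (A : set T)
    (g : T -> U) (h : T -> F) :
    (forall x y, A x -> A y -> h x = h y -> g x = g y) ->
  finite_set (g @` A)%classic.
Proof.
move=> gh; have [[x0 Ax0]|A0] := pselect (exists x, A x); last first.
  suff -> : (g @` A = set0)%classic by exact: finite_set0.
  by apply/seteqP; split=> // y [x Ax]; case: A0; exists x.
(* [r] picks a preimage in [A] of each attained value; [x0] is the default for the others. *)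
have /choice[r rP] : forall t, exists y, (exists x, A x /\ h x = t) -> A y /\ h y = t.
  by move=> t; have [[x xP]|nx] := pselect (exists x, A x /\ h x = t); [exists x|exists x0].
apply: (@sub_finite_set _ _ ((g \o r) @` [set: F])%classic).
  move=> _ [x Ax <-]; exists (h x) => //=.
  have [|Ar hr] := rP (h x); first by exists x.
  exact: gh.
exact/finite_image/finite_finset.
Qed.

Lemma corners_not_flexible G l a b c :
  is_labeling G l -> corners G a b c -> ~ flexible G l.
Proof.
move=> l_gt0 abc; apply; apply: (@finite_image_factor _ _ _ _ _ (signs a b c)).
move=> rho rho' rhoP rhoP' sgn; apply/seteqP; split=> rho'' /=.
  (* Swapping the two realizations gives the reverse equivalence. *)
  by apply: equivalent_trans; apply: signs_equivalent rhoP' rhoP (esym sgn).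
by apply: equivalent_trans; apply: signs_equivalent rhoP rhoP' sgn.
Qed.

End Rigidity.

Theorem theorem5 (R : realType) (V : finType) (G : sgraph V)
    (hE : (1 <= #|edges G|)%N) (hflex : has_flexible_labeling R G) :
  (#|edges G|%:R : rat) <=
    #|V|%:R * (#|V|%:R - 1) / 2%:R - (#|V|%:R - 2%:R).
Proof.
case: hflex => l [l_gt0 flex].
have Vsmall : (#|V| <= #|nonedges G| + 2)%N.
  rewrite leqNgt; apply/negP => Vlarge.
  have [|a [b [c abc]]] := @corners_exist V G; first by lia.
  exact: corners_not_flexible l_gt0 abc flex.
have total : (#|edges G| + #|nonedges G|)%:R = #|V|%:R * (#|V|%:R - 1) / 2%:R :> rat.
  apply: (canRL (mulfK _)) => //.
  rewrite card_edges_nonedges -natrM mulnC -mul_bin_diag bin1 natrM.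
  (* The predecessor in [nat] is truncated at zero, so the empty vertex set is a separate case. *)
  by case: #|V| => [|n]; rewrite ?mul0r //= -natr1 addrK.
by move: Vsmall; rewrite -total -(ler_nat rat) !natrD; lra.
Qed.
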